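(* Let $X$ be a centered isotropic log-concave random vector in $\mathbb R^n$ verifying the variance conjecture with constant $C_1$, i.e. $\operatorname{Var}|X|^2\le C_1\lambda_X^2\,\mathbb E|X|^2$ (which for isotropic $X$ reads $\operatorname{Var}|X|^2\le C_1 n$). Let $T\in GL(n)$ be any linear transformation. If $U$ is a random map uniformly distributed in $O(n)$, then $$\mathbb E_U\operatorname{Var}|T\circ U(X)|^2\le C\,C_1\|T\|_{op}^2\|T\|_{HS}^2=C\,C_1\,\lambda_{T\circ u(X)}^2\,\mathbb E|T\circ u(X)|^2$$ for any $u\in O(n)$, where $C$ is an absolute constant.
   Context: A random vector $X$ in $\mathbb R^n$ is log-concave if it has a density $e^{-V}$ with respect to Lebesgue measure, for some convex $V:\mathbb R^n\to(-\infty,\infty]$. It is isotropic if $\mathbb EX=0$ and $\mathbb E\langle X,e_i\rangle\langle X,e_j\rangle=\delta_{i,j}$ for all $1\le i,j\le n$, where $\{e_i\}$ is the canonical basis. $|\cdot|$ is the Euclidean norm and $S^{n-1}$ the Euclidean unit sphere. For a centered random vector $Z$ in $\mathbb R^n$, $\lambda_Z^2=\sup_{\xi\in S^{n-1}}\mathbb E\langle Z,\xi\rangle^2$. $O(n)$ is the orthogonal group, and uniformly distributed means distributed according to Haar probability measure. In $\mathbb E_U\operatorname{Var}|T\circ U(X)|^2$ the variance is taken with respect to $X$ for fixed $U$, and then the expectation is taken over $U$. $\|T\|_{op}$ and $\|T\|_{HS}$ are the operator norm on $\ell_2^n$ and the Hilbert–Schmidt norm. ''Absolute constant'' means a positive number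 independent of $n$, $X$, $T$ and $C_1$.
   Formalization: The constant C_1 is assumed to be at least 1; with C_1 allowed to tend to 0 the claim fails for an absolute C (X uniform on a ball with C_1 = 4/(n+4), T diagonal with half its entries 2 and half 1). *)

(* Defs.v *)
From HB Require Import structures.
From mathcomp Require Import all_boot all_order all_algebra.
From mathcomp Require Import all_classical all_reals all_analysis.
From mathcomp Require Import measurable_realfun.
Set Implicit Arguments.
Unset Strict Implicit.
Unset Printing Implicit Defensive.
Import Order.TTheory GRing.Theory Num.Theory.
Import numFieldNormedType.Exports.
Local Open Scope classical_set_scope.
Local Open Scope ring_scope.

(* The sigma-algebra generated by the entries; since matrices over R form a
   second countable space, it is the Borel sigma-algebra. *)
Definition measure_matrix_display : measure_display -> measure_display.
Proof. exact. Qed.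

Section measurable_matrix.
Context {R : realType} (m n : nat).

Definition matrix_measurable : set (set 'M[R]_(m, n)) :=
  <<s \bigcup_(ij in [set: 'I_m * 'I_n])
        preimage_set_system setT (fun M : 'M[R]_(m, n) => M ij.1 ij.2)
          (@measurable _ R) >>.

Let matrix_measurable0 : matrix_measurable set0.
Proof. exact: sigma_algebra0. Qed.

Let matrix_measurableC A : matrix_measurable A -> matrix_measurable (~` A).
Proof. exact: sigma_algebraC. Qed.

Let matrix_measurable_bigcup (F : (set 'M[R]_(m, n))^nat) :
  (forall i, matrix_measurable (F i)) -> matrix_measurable (\bigcup_i (F i)).
Proof. exact: sigma_algebra_bigcup. Qed.

HB.instance Definition _ := @isMeasurable.Build
  (measure_matrix_display default_measure_display) 'M[R]_(m, n)
  matrix_measurable matrix_measurable0 matrix_measurableC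
  matrix_measurable_bigcup.

Lemma measurable_entry (i : 'I_m) (j : 'I_n) :
  measurable_fun [set: 'M[R]_(m, n)] (fun M => M i j : R).
Proof.
move=> _ Y mY; rewrite setTI; apply: sub_sigma_algebra.
by exists (i, j) => //; exists Y => //; rewrite setTI.
Qed.

Lemma measurable_fun_entryP d (T : measurableType d) (f : T -> 'M[R]_(m, n)) :
  (forall i j, measurable_fun [set: T] (fun t => f t i j : R)) ->
  measurable_fun [set: T] f.
Proof.
move=> mf; apply: (@measurability _ _ _ _ _ _
  (\bigcup_(ij in [set: 'I_m * 'I_n])
     preimage_set_system setT (fun M : 'M[R]_(m, n) => M ij.1 ij.2)
       (@measurable _ R))) => //.
move=> _ [_ [[i j] _ [B mB <-]] <-].
rewrite [X in _ `&` X](_ : _ = (fun t => f t i j) @^-1` B); first exact: mf.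
by rewrite setTI.
Qed.

End measurable_matrix.

(* Lebesgue measure on R^n, by the decomposition R^(n+1) = R x R^n. *)
Section lebesgue_measure_Rn.
Context {R : realType}.

Definition cons_col n (p : R * 'cV[R]_n) : 'cV[R]_n.+1 :=
  col_mx (const_mx p.1 : 'cV[R]_1) p.2.

Definition uncons_col n (v : 'cV[R]_n.+1) : R * 'cV[R]_n :=
  (v ord0 ord0, dsubmx (v : 'M[R]_(1 + n, 1))).

Lemma cons_col0 n x (v : 'cV[R]_n) j : cons_col (x, v) ord0 j = x.
Proof.
have := col_mxEu (const_mx x : 'cV[R]_1) v ord0 j.
rewrite [in RHS]mxE; apply: etrans.
by congr (col_mx _ _ _ _); exact/val_inj.
Qed.

Lemma cons_colS n x (v : 'cV[R]_n) i j :
  cons_col (x, v) (lift ord0 i) j = v i j.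
Proof.
have := col_mxEd (const_mx x : 'cV[R]_1) v i j; apply: etrans.
by congr (col_mx _ _ _ _); exact/val_inj.
Qed.

Lemma cons_colK n : cancel (@cons_col n) (@uncons_col n).
Proof.
move=> [x v]; rewrite /uncons_col cons_col0; congr pair.
exact: col_mxKd.
Qed.

Lemma measurable_cons_col n : measurable_fun setT (@cons_col n).
Proof.
apply: measurable_fun_entryP => i j; case: (unliftP ord0 i) => [k|] ->.
- rewrite (_ : (fun p => _) = (fun v : 'cV[R]_n => v k j) \o snd).
    by apply: measurableT_comp => //; exact: measurable_entry.
  by apply/funext => -[x v]; rewrite cons_colS.
- rewrite (_ : (fun p => _) = fst); first exact: measurable_fst.
  by apply/funext => -[x v]; rewrite cons_col0.
Qed.

Lemma measurable_uncons_col n : measurable_fun setT (@uncons_col n).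
Proof.
apply: measurable_fun_pair; first exact: measurable_entry.
apply: measurable_fun_entryP => i j.
under eq_fun do rewrite mxE.
exact: measurable_entry.
Qed.

Section step.
Context n (mu : {sigma_finite_measure set 'cV[R]_n -> \bar R}).

Definition lebesgue_cons : set 'cV[R]_n.+1 -> \bar R :=
  pushforward (@lebesgue_measure R \x mu)%E (@cons_col n).

Let mcons := @measurable_cons_col n.

Let lebesgue_cons0 : lebesgue_cons set0 = 0%E.
Proof. by rewrite /lebesgue_cons /pushforward preimage_set0 measure0. Qed.

Let lebesgue_cons_ge0 A : (0 <= lebesgue_cons A)%E.
Proof. exact: measure_ge0. Qed.

Let lebesgue_cons_sigma_additive : semi_sigma_additive lebesgue_cons.
Proof. by apply: measure_semi_sigma_additive; exact: mcons. Qed.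

HB.instance Definition _ := isMeasure.Build _ _ _ lebesgue_cons
  lebesgue_cons0 lebesgue_cons_ge0 lebesgue_cons_sigma_additive.

Let sigma_finite_lebesgue_cons : sigma_finite setT lebesgue_cons.
Proof.
have /sigma_finiteP[F [FT ndF Foo]] := sigma_finiteT (@lebesgue_measure R).
have /sigma_finiteP[G [GT ndG Goo]] := sigma_finiteT mu.
exists (fun k => @uncons_col n @^-1` (F k `*` G k)).
  rewrite -preimage_bigcup; apply/esym/seteqP; split=> // v _ /=.
  case: (uncons_col v) => x w; have : setT x by []. rewrite FT => -[k _ Fkx].
  have : setT w by []. rewrite GT => -[l _ Glw].
  exists (maxn k l) => //; split=> /=.
    by move: x Fkx; exact/subsetPset/ndF/leq_maxl.
  by move: w Glw; exact/subsetPset/ndG/leq_maxr.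
move=> k; have [mF Fk] := Foo k; have [mG Gk] := Goo k; split.
  rewrite -[X in measurable X]setTI.
  by apply: measurable_uncons_col => //; exact: measurableX.
rewrite /lebesgue_cons /pushforward -comp_preimage.
rewrite (_ : _ \o _ = id) ?preimage_id; last first.
  by apply/funext => p; exact: cons_colK.
by rewrite product_measure1E// lte_mul_pinfty// ge0_fin_numE.
Qed.

HB.instance Definition _ := Measure_isSigmaFinite.Build _ _ _ lebesgue_cons
  sigma_finite_lebesgue_cons.

End step.

Fixpoint lebesgue_Rn n : {sigma_finite_measure set 'cV[R]_n -> \bar R} :=
  match n with
  | 0%N => @dirac _ 'cV[R]_0 0 R
  | n'.+1 => lebesgue_cons (lebesgue_Rn n')
  end.

Lemma lebesgue_Rn_box n (A : 'I_n -> set R) : (forall i, measurable (A i)) ->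
  lebesgue_Rn n [set v : 'cV[R]_n | forall i, A i (v i ord0)] =
  (\prod_(i < n) lebesgue_measure (A i : set (measurableTypeR R)))%E.
Proof.
elim: n => [|n IHn] in A *; move=> mA.
  by rewrite big_ord0 /= diracE mem_set//= => -[].
rewrite big_ord_recl -IHn//.
pose B : set 'cV[R]_n := [set v | forall i, A (lift ord0 i) (v i ord0)].
have mB : measurable B.
  rewrite (_ : B = \big[setI/setT]_(i < n)
      ((fun v : 'cV[R]_n => v i ord0 : R) @^-1` A (lift ord0 i))).
    apply: bigsetI_measurable => i _; rewrite -[X in measurable X]setTI.
    by apply: measurable_entry.
  rewrite -bigcap_seq; apply/seteqP; split=> v /= Av i.
    by move=> _; exact: Av.
  by apply: Av => /=; rewrite mem_index_enum.
rewrite -/B -product_measure1E//=; last exact: mA.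
rewrite /lebesgue_cons /pushforward.
congr (_ _); apply/seteqP; split=> [[x v] /= vA|[x v] /= [xA vB] i].
  split; first by move: (vA ord0); rewrite cons_col0.
  by move=> i; move: (vA (lift ord0 i)); rewrite cons_colS.
by case: (unliftP ord0 i) => [j|] ->; rewrite ?cons_colS ?cons_col0//; exact: vB.
Qed.

End lebesgue_measure_Rn.

Section euclidean.
Context {R : realType} (n : nat).
Implicit Types (u v : 'cV[R]_n) (T : 'M[R]_n).

Definition dotv u v : R := \sum_(i < n) u i ord0 * v i ord0.

(* The library norm on matrices is the sup norm. *)
Definition enorm v : R := Num.sqrt (dotv v v).

Definition unit_sphere : set 'cV[R]_n := [set xi | enorm xi = 1].

Definition op_norm T : R := sup [set enorm (T *m xi) | xi in unit_sphere].

Definition hs_norm T : R := Num.sqrt (\sum_i \sum_j T i j ^+ 2).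

Definition orthogonal_group : set 'M[R]_n := [set U | U^T *m U = 1%:M].

End euclidean.

Section random_vectors.
Context {R : realType} d (Omega : measurableType d) (P : probability Omega R).
Context (n : nat).
Implicit Type X : Omega -> 'cV[R]_n.
Local Open Scope ereal_scope.

(* V takes its values in ]-oo, +oo], so the sum below is never +oo - oo. *)
Definition convex_ext (V : 'cV[R]_n -> \bar R) :=
  (forall x, V x != -oo) /\
  forall x y (t : R), (0 <= t <= 1)%R ->
    V (t *: x + (1 - t) *: y)%R <= t%:E * V x + (1 - t)%:E * V y.

Definition has_density (X : {mfun Omega >-> 'cV[R]_n})
    (f : 'cV[R]_n -> \bar R) :=
  measurable_fun setT f /\
  forall A, measurable A ->
    distribution P X A = \int[lebesgue_Rn n]_(x in A) f x.

Definition log_concave (X : {mfun Omega >-> 'cV[R]_n}) :=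
  exists V, convex_ext V /\ has_density X (fun x => expeR (- V x)).

Definition centered X := forall i, 'E_P[fun w => X w i ord0] = 0.

Definition isotropic X :=
  centered X /\
  forall i j, 'E_P[fun w => (X w i ord0 * X w j ord0)%R] = (i == j)%:R%:E.

Definition lambda_sq X : \bar R :=
  ereal_sup [set 'E_P[fun w => (dotv (X w) xi ^+ 2)%R] | xi in @unit_sphere R n].

Definition variance_conjecture_with (C1 : R) X :=
  'V_P[fun w => (enorm (X w) ^+ 2)%R] <=
  C1%:E * lambda_sq X * 'E_P[fun w => (enorm (X w) ^+ 2)%R].

(* Left invariance characterizes the Haar probability measure of O(n). *)
Definition uniform_on_orthogonal_group (U : {mfun Omega >-> 'M[R]_n}) :=
  (forall w, orthogonal_group (U w)) /\
  forall g, orthogonal_group g -> forall A, measurable A ->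
    distribution P U [set M | A (g *m M)] = distribution P U A.

End random_vectors.

(* Main.v *)
Require Import Defs.
From HB Require Import structures.
From mathcomp Require Import all_boot all_order all_algebra.
From mathcomp Require Import all_classical all_reals all_analysis.
From mathcomp Require Import measurable_realfun.
From mathcomp Require Import ring lra.
Set Implicit Arguments.
Unset Strict Implicit.
Unset Printing Implicit Defensive.
Import Order.TTheory GRing.Theory Num.Theory.
Import numFieldNormedType.Exports.
Local Open Scope classical_set_scope.
Local Open Scope ring_scope.

(** Write h = ||T||_HS^2, a = ||T||_op^2 and g = ||T T^T||_HS^2. For fixed x
the vector U x is uniform on the sphere of radius |x|, so the mean over U of
|T U x|^4 is an explicit multiple of |x|^4, namely
   |x|^4 (h^2 + 2 g) / (n (n + 2))                 ([haar_fourth_moment]).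
By isotropy E |T u X|^2 = h for each orthogonal u, hence, exchanging the two
integrals,
   E_U Var |T U X|^2 + h^2 = E |X|^4 (h^2 + 2 g) / (n (n + 2))
                                                   ([average_variance]).
The variance conjecture gives E |X|^4 <= C1 n + n^2
([isotropic_fourth_moment_le]), so that the average variance is at most
   2 g (C1 + n) / (n + 2) + h^2 (C1 - 2) / (n + 2).
The terms of order h^2 cancel up to a factor C1 / n; as h <= n a and g <= a h
([hs_norm_le_op], [hs_norm_gram_le]), what is left is at most 3 C1 a h.

The spherical moments come from left invariance alone. The function
z |-> E_U <z, U x>^4 is invariant under reflections, which act transitively on
spheres, so it equals c |z|^4 ([haar_moment4E]). Polarizing,
E_U <z, U x>^2 <w, U x>^2 = (c / 3) (|z|^2 |w|^2 + 2 <z, w>^2)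
([haar_moment22E]); summing over pairs of rows z, w of a matrix S gives
E_U |S U x|^4, and S = 1, for which |S U x| = |x|, determines c.

In the second part, E <T u X, xi>^2 = |(T u)^T xi|^2 has supremum
||(T u)^T||_op^2 over the sphere ([isotropic_lambda_sq]), and the operator norm
is invariant under transposition and under composition with u. *)

(** * Euclidean geometry *)

Section dot_product.
Context {R : realType} (n : nat).
Implicit Types (u v w z : 'cV[R]_n) (T g : 'M[R]_n) (a : R).

Lemma dotvE u v : dotv u v = (u^T *m v) ord0 ord0.
Proof. by rewrite mxE; apply: eq_bigr => i _; rewrite mxE. Qed.

Lemma dotvC u v : dotv u v = dotv v u.
Proof. by apply: eq_bigr => i _; rewrite mulrC. Qed.

Lemma dotvDl u v w : dotv (u + v) w = dotv u w + dotv v w.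
Proof. by rewrite -big_split; apply: eq_bigr => i _; rewrite mxE mulrDl. Qed.

Lemma dotvZl a u v : dotv (a *: u) v = a * dotv u v.
Proof. by rewrite mulr_sumr; apply: eq_bigr => i _; rewrite mxE mulrA. Qed.

Lemma dotvBl u v w : dotv (u - v) w = dotv u w - dotv v w.
Proof. by rewrite -scaleN1r dotvDl dotvZl mulN1r. Qed.

Lemma dotvDr u v w : dotv w (u + v) = dotv w u + dotv w v.
Proof. by rewrite dotvC dotvDl !(dotvC w). Qed.

Lemma dotvZr a u v : dotv u (a *: v) = a * dotv u v.
Proof. by rewrite dotvC dotvZl dotvC. Qed.

Lemma dotvBr u v w : dotv w (u - v) = dotv w u - dotv w v.
Proof. by rewrite dotvC dotvBl !(dotvC w). Qed.

Lemma dotv_mulmxl T u v : dotv (T *m u) v = dotv u (T^T *m v).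
Proof. by rewrite !dotvE trmx_mul -mulmxA. Qed.

Lemma dotv_ge0 v : 0 <= dotv v v.
Proof. by apply: sumr_ge0 => i _; rewrite -expr2 sqr_ge0. Qed.

Lemma dotv_eq0 v : dotv v v = 0 -> v = 0.
Proof.
move/eqP; rewrite psumr_eq0 => [/allP v0|i _]; last by rewrite -expr2 sqr_ge0.
apply/colP => i; rewrite mxE; apply/eqP; rewrite -sqrf_eq0 expr2.
by apply: v0; rewrite mem_index_enum.
Qed.

Lemma enorm_ge0 v : 0 <= enorm v. Proof. exact: sqrtr_ge0. Qed.

Lemma enorm_sqr v : enorm v ^+ 2 = dotv v v.
Proof. by rewrite sqr_sqrtr ?dotv_ge0. Qed.

(** The square of the length of [|v|^2 u - <u, v> v] is nonnegative. *)
Lemma dotv_cauchy_schwarz u v : dotv u v ^+ 2 <= dotv u u * dotv v v.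
Proof.
have [/dotv_eq0 ->|v0] := eqVneq (dotv v v) 0.
  by rewrite -[0](scale0r 0) !dotvZr !mul0r mulr0 expr0n.
have vp : 0 < dotv v v by rewrite lt_neqAle eq_sym v0 dotv_ge0.
rewrite -subr_ge0 -(pmulr_rge0 _ vp).
have := dotv_ge0 (dotv v v *: u - dotv u v *: v).
rewrite !(dotvBl, dotvBr, dotvZl, dotvZr) (dotvC v u).
by congr (_ <= _); ring.
Qed.

Lemma unit_sphereP v : unit_sphere v <-> dotv v v = 1.
Proof.
rewrite /unit_sphere /= /enorm; split=> [v1|->]; last exact: sqrtr1.
by rewrite -enorm_sqr /enorm v1 expr1n.
Qed.

Lemma unit_sphere_normalize v : v != 0 -> unit_sphere ((enorm v)^-1 *: v).
Proof.
move=> v0; apply/unit_sphereP; rewrite dotvZl dotvZr -enorm_sqr.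
have : enorm v != 0.
  by apply: contra v0 => /eqP v0; rewrite (@dotv_eq0 v)// -enorm_sqr v0 expr0n.
by move=> ?; field.
Qed.

(** The reflection in the hyperplane orthogonal to [z - w] exchanges [z] and
    [w]. It is stated with [g^T] because [g] gets moved across a dot product. *)
Lemma orthogonal_transitive z w : dotv z z = dotv w w ->
  exists2 g, orthogonal_group g & g^T *m z = w.
Proof.
move=> zw; have [->|zw0] := eqVneq z w.
  by exists 1%:M; rewrite /orthogonal_group/= trmx1 ?mulmx1 ?mul1mx.
pose v := z - w; pose c := 2 / dotv v v.
have v0 : dotv v v != 0 by apply: contra zw0 => /eqP/dotv_eq0/eqP; rewrite subr_eq0.
have symg : (1%:M - c *: (v *m v^T))^T = 1%:M - c *: (v *m v^T).
  by rewrite linearB linearZ /= trmx_mul trmxK trmx1.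
have vv : v^T *m v = (dotv v v)%:M.
  by rewrite dotvE -mx11_scalar.
exists (1%:M - c *: (v *m v^T)).
  rewrite /orthogonal_group /= symg mulmxBl mul1mx mulmxBr mulmx1.
  rewrite -!scalemxAl -!scalemxAr mulmxA -(mulmxA v) vv mul_mx_scalar -scalemxAl.
  rewrite !scalerA (_ : c * (c * dotv v v) = c + c); last by rewrite /c; field.
  by rewrite scalerDl opprB addrK subrK.
rewrite symg mulmxBl mul1mx -scalemxAl -mulmxA.
rewrite [v^T *m z]mx11_scalar -dotvE mul_mx_scalar scalerA.
rewrite (_ : c * _ = 1) ?scale1r ?/v ?subKr//.
have vz : dotv v v = 2 * dotv v z.
  by rewrite /v !(dotvBl, dotvBr) -zw (dotvC w z); ring.
by move: v0; rewrite /c vz => v0; field; move: v0; rewrite mulf_eq0 pnatr_eq0.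
Qed.

Lemma orthogonal_group_tr g : orthogonal_group g -> orthogonal_group g^T.
Proof. by rewrite /orthogonal_group /= trmxK => /mulmx1C. Qed.

Lemma dotv_orthogonal g u v : orthogonal_group g ->
  dotv (g *m u) (g *m v) = dotv u v.
Proof. by move=> og; rewrite dotv_mulmxl mulmxA og mul1mx. Qed.

End dot_product.

(** * Operator and Hilbert-Schmidt norms *)

Section matrix_norms.
Context {R : realType} (n : nat).
Implicit Types (u v : 'cV[R]_n) (T g : 'M[R]_n).

(** A row of [T] as a column vector, so that [dotv] applies to it. *)
Definition rowv T i : 'cV[R]_n := (row i T)^T.

Lemma mulmx_rowv T v i : (T *m v) i ord0 = dotv (rowv T i) v.
Proof. by rewrite mxE; apply: eq_bigr => j _; rewrite !mxE. Qed.

Lemma dotv_mulmx_rowv T v :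
  dotv (T *m v) (T *m v) = \sum_i dotv (rowv T i) v ^+ 2.
Proof. by apply: eq_bigr => i _; rewrite mulmx_rowv. Qed.

Lemma hs_norm_sqr T : hs_norm T ^+ 2 = \sum_i dotv (rowv T i) (rowv T i).
Proof.
rewrite sqr_sqrtr; last by apply: sumr_ge0 => i _; apply: sumr_ge0 => j _; exact: sqr_ge0.
by apply: eq_bigr => i _; apply: eq_bigr => j _; rewrite !mxE.
Qed.

Lemma hs_norm_orthogonal T g : orthogonal_group g ->
  hs_norm (T *m g) ^+ 2 = hs_norm T ^+ 2.
Proof.
move=> /orthogonal_group_tr og; rewrite !hs_norm_sqr; apply: eq_bigr => i _.
rewrite (_ : rowv (T *m g) i = g^T *m rowv T i) ?dotv_orthogonal//.
by rewrite /rowv row_mul trmx_mul.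
Qed.

Lemma dotv_mulmx_le_hs T v :
  dotv (T *m v) (T *m v) <= hs_norm T ^+ 2 * dotv v v.
Proof.
rewrite dotv_mulmx_rowv hs_norm_sqr mulr_suml.
by apply: ler_sum => i _; exact: dotv_cauchy_schwarz.
Qed.

(** Without an upper bound the supremum defining [op_norm] would be a junk
    value. *)
Lemma op_norm_has_ubound T :
  has_ubound [set enorm (T *m xi) | xi in @unit_sphere R n].
Proof.
exists (hs_norm T) => _ [xi /unit_sphereP xi1 <-].
rewrite -(@ler_pXn2r _ 2)// ?nnegrE ?enorm_ge0 ?sqrtr_ge0//.
by rewrite enorm_sqr (le_trans (dotv_mulmx_le_hs _ _))// xi1 mulr1.
Qed.

Lemma unit_sphere_nonempty : (0 < n)%N -> exists xi : 'cV[R]_n, unit_sphere xi.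
Proof.
case: n => // m _; exists (delta_mx ord0 ord0); apply/unit_sphereP.
by rewrite dotvE trmx_delta mul_delta_mx mxE !eqxx.
Qed.

Lemma enorm_le_op_norm T xi : unit_sphere xi -> enorm (T *m xi) <= op_norm T.
Proof. by move=> xi1; apply: (ub_le_sup (op_norm_has_ubound T)); exists xi. Qed.

Lemma op_norm_ge0 T : (0 < n)%N -> 0 <= op_norm T.
Proof.
move=> /unit_sphere_nonempty[xi xi1].
by rewrite (le_trans _ (enorm_le_op_norm T xi1))// enorm_ge0.
Qed.

Lemma op_norm_le T (a : R) : (0 < n)%N ->
  (forall xi, unit_sphere xi -> enorm (T *m xi) <= a) -> op_norm T <= a.
Proof.
move=> /unit_sphere_nonempty[xi xi1] Ta; apply: ge_sup.
  by exists (enorm (T *m xi)), xi.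
by move=> _ [z /Ta ? <-].
Qed.

Lemma dotv_mulmx_le_op T v :
  dotv (T *m v) (T *m v) <= op_norm T ^+ 2 * dotv v v.
Proof.
have [->|v0] := eqVneq v 0.
  by rewrite mulmx0 -[0](scale0r 0) !dotvZr !mul0r mulr0.
have /unit_sphere_normalize xi1 := v0.
have vE : v = enorm v *: ((enorm v)^-1 *: v).
  rewrite scalerA divff ?scale1r//; apply: contra v0 => /eqP v0.
  by rewrite (@dotv_eq0 _ _ v)// -enorm_sqr v0 expr0n.
rewrite {1 2}vE -scalemxAr dotvZl dotvZr mulrA -expr2 mulrC -!enorm_sqr.
rewrite ler_wpM2r ?sqr_ge0// lerXn2r// ?nnegrE ?enorm_ge0//.
  by rewrite (le_trans _ (enorm_le_op_norm T xi1)) ?enorm_ge0.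
exact: enorm_le_op_norm.
Qed.

(** An orthogonal matrix maps the sphere into itself; the converse inequality
    comes from its inverse. *)
Lemma op_norm_orthogonal T g : (0 < n)%N -> orthogonal_group g ->
  op_norm (T *m g) = op_norm T.
Proof.
move=> n0 og; have le_op (S k : 'M[R]_n) : orthogonal_group k -> op_norm (S *m k) <= op_norm S.
  move=> ok; apply: op_norm_le => // xi xi1; rewrite -mulmxA enorm_le_op_norm//.
  by apply/unit_sphereP; rewrite dotv_orthogonal//; exact/unit_sphereP.
apply/eqP; rewrite eq_le le_op//= -{1}(mulmx1 T) -(mulmx1C og) mulmxA.
by rewrite le_op//; exact: orthogonal_group_tr.
Qed.

(** [|T^T xi|^2 = <xi, T T^T xi> <= |T T^T xi| <= ||T||_op |T^T xi|] for a unit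
    vector [xi]. *)
Lemma op_norm_tr_le T : (0 < n)%N -> op_norm T^T <= op_norm T.
Proof.
move=> n0; apply: op_norm_le => // xi /unit_sphereP xi1.
have [->|t0] := eqVneq (enorm (T^T *m xi)) 0; first exact: op_norm_ge0.
have tp : 0 < enorm (T^T *m xi) by rewrite lt_neqAle eq_sym t0 enorm_ge0.
rewrite -(ler_pM2r tp) -expr2 -(@ler_pXn2r _ 2)// ?nnegrE ?sqr_ge0//; last first.
  by rewrite mulr_ge0 ?op_norm_ge0 ?enorm_ge0.
rewrite [in leRHS]exprMn !enorm_sqr.
apply: le_trans _ (dotv_mulmx_le_op _ _).
rewrite dotv_mulmxl trmxK; apply: le_trans (dotv_cauchy_schwarz _ _) _.
by rewrite xi1 mul1r.
Qed.

Lemma op_norm_tr T : (0 < n)%N -> op_norm T^T = op_norm T.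
Proof.
move=> n0; apply/eqP; rewrite eq_le op_norm_tr_le//=.
by rewrite -[in leLHS](trmxK T) op_norm_tr_le.
Qed.

Lemma hs_norm_gram T :
  hs_norm (T *m T^T) ^+ 2 = \sum_i \sum_j dotv (rowv T i) (rowv T j) ^+ 2.
Proof.
rewrite hs_norm_sqr; apply: eq_bigr => i _; apply: eq_bigr => j _.
rewrite -expr2 !mxE; congr (_ ^+ 2).
by apply: eq_bigr => k _; rewrite !mxE.
Qed.

(** Apply the bound by the operator norm to the rows of [T] and sum. *)
Lemma hs_norm_gram_le T :
  hs_norm (T *m T^T) ^+ 2 <= op_norm T ^+ 2 * hs_norm T ^+ 2.
Proof.
rewrite hs_norm_gram hs_norm_sqr mulr_sumr; apply: ler_sum => i _.
rewrite (le_trans _ (dotv_mulmx_le_op T (rowv T i)))// dotv_mulmx_rowv.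
by apply: ler_sum => j _; rewrite dotvC.
Qed.

Lemma hs_norm1 : hs_norm (1%:M : 'M[R]_n) ^+ 2 = n%:R.
Proof.
rewrite hs_norm_sqr (eq_bigr (fun=> 1)) ?sumr_const ?card_ord// => i _.
by rewrite dotvE trmxK /rowv row1 trmx_delta mul_delta_mx mxE !eqxx.
Qed.

(** Apply the bound by the operator norm to the vectors of the canonical basis,
    whose images under [T^T] are the rows of [T]. *)
Lemma hs_norm_le_op T : (0 < n)%N -> hs_norm T ^+ 2 <= n%:R * op_norm T ^+ 2.
Proof.
move=> n0; rewrite hs_norm_sqr.
rewrite (_ : n%:R * _ = \sum_(i < n) op_norm T ^+ 2); last first.
  by rewrite sumr_const card_ord mulr_natl.
apply: ler_sum => i _.
have := dotv_mulmx_le_op T^T (delta_mx i ord0).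
rewrite op_norm_tr// [dotv (delta_mx _ _) _]dotvE trmx_delta mul_delta_mx mxE !eqxx mulr1.
by rewrite -[T^T *m _]colE -tr_row.
Qed.

End matrix_norms.

(** * Measurability and integrability *)

Section measurability.
Context {R : realType} d (Omega : measurableType d).

Lemma measurable_mulmx m n p (A : Omega -> 'M[R]_(m, n))
    (B : Omega -> 'M[R]_(n, p)) :
  measurable_fun setT A -> measurable_fun setT B ->
  measurable_fun setT (fun w => A w *m B w).
Proof.
move=> mA mB; apply: measurable_fun_entryP => i j.
under eq_fun do rewrite mxE.
apply: measurable_sum => k; apply: measurable_funM.
  exact: (measurableT_comp (measurable_entry i k)).
exact: (measurableT_comp (measurable_entry k j)).
Qed.

Lemma measurable_dotv n (u v : Omega -> 'cV[R]_n) :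
  measurable_fun setT u -> measurable_fun setT v ->
  measurable_fun setT (fun w => dotv (u w) (v w)).
Proof.
move=> mu mv; apply: measurable_sum => k; apply: measurable_funM.
  exact: (measurableT_comp (measurable_entry k ord0)).
exact: (measurableT_comp (measurable_entry k ord0)).
Qed.

Lemma bounded_integrable (P : probability Omega R) (f : Omega -> R) (M : R) :
  measurable_fun setT f -> (forall w, `|f w| <= M) ->
  P.-integrable setT (EFin \o f).
Proof.
move=> mf fM; apply: measurable_bounded_integrable => //.
  by rewrite -ge0_fin_numE ?fin_num_measure.
by exists M; split; [exact: num_real|move=> x /ltW Mx w _; exact: le_trans Mx].
Qed.

End measurability.

(** * Moments of a Haar-distributed rotation *)

Section haar_moments.
Context {R : realType} (n : nat) d (Omega : measurableType d).
Context (Q : probability Omega R) (U : {mfun Omega >-> 'M[R]_n}).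
Hypothesis n_gt0 : (0 < n)%N.
Hypothesis haarU : uniform_on_orthogonal_group Q U.

Lemma integral_left_invariant (g : 'M[R]_n) (f : 'M[R]_n -> R) :
  orthogonal_group g -> measurable_fun setT f -> (forall M, 0 <= f M) ->
  \int[Q]_w f (g *m U w) = \int[Q]_w f (U w).
Proof.
move=> og mf f0; congr fine.
have mgU : measurable_fun setT (fun w => g *m U w).
  by apply: measurable_mulmx => //; exact: measurable_cst.
pose gU : {mfun Omega >-> 'M[R]_n} := HB.pack (fun w => g *m U w)
  (isMeasurableFun.Build _ _ _ _ _ mgU).
have mEf : measurable_fun setT (EFin \o f) by exact/measurable_EFinP.
have f0' M : (0 <= (EFin \o f) M)%E by rewrite lee_fin.
rewrite -[LHS](@ge0_integral_distribution _ _ _ _ _ Q gU _ mEf f0').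
rewrite -[RHS](@ge0_integral_distribution _ _ _ _ _ Q U _ mEf f0').
by apply: eq_measure_integral => A mA _; exact: (haarU.2 g og A mA).
Qed.

Context (x : 'cV[R]_n).
Implicit Types (z w : 'cV[R]_n).

Let y t := U t *m x.

Let my : measurable_fun setT y.
Proof. by apply: measurable_mulmx => //; exact: measurable_cst. Qed.

Let dotv_y t : dotv (y t) (y t) = dotv x x.
Proof. exact/dotv_orthogonal/haarU.1. Qed.

Let mdot z : measurable_fun setT (fun t => dotv z (y t)).
Proof. by apply: measurable_dotv => //; exact: measurable_cst. Qed.

Let dot_le z t : dotv z (y t) ^+ 2 <= dotv z z * dotv x x.
Proof. by rewrite -(dotv_y t) dotv_cauchy_schwarz. Qed.

Let int4 z : Q.-integrable setT (EFin \o (fun t => dotv z (y t) ^+ 4)).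
Proof.
apply: (@bounded_integrable _ _ _ _ _ ((dotv z z * dotv x x) ^+ 2)).
  exact: measurable_funX.
move=> t; rewrite (exprM _ 2 2) ger0_norm ?sqr_ge0// lerXn2r// ?nnegrE ?sqr_ge0//.
by rewrite mulr_ge0 ?dotv_ge0.
Qed.

Definition haar_moment4 z := \int[Q]_t (dotv z (U t *m x) ^+ 4).

(** If [w = g^T z] then [<w, U x> = <z, g U x>], and [g U] has the law of [U]. *)
Lemma haar_moment4_isotropic z w : dotv z z = dotv w w ->
  haar_moment4 z = haar_moment4 w.
Proof.
move=> /orthogonal_transitive[g og <-].
rewrite /haar_moment4 -(@integral_left_invariant g (fun M => dotv z (M *m x) ^+ 4))//.
- by apply: eq_Rintegral => t _; rewrite dotv_mulmxl trmxK mulmxA.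
- apply: measurable_funX; apply: measurable_dotv; first exact: measurable_cst.
  by apply: measurable_mulmx => //; exact: measurable_cst.
- by move=> M; rewrite (exprM _ 2 2) sqr_ge0.
Qed.

Lemma haar_moment4E : exists c, forall z, haar_moment4 z = c * dotv z z ^+ 2.
Proof.
have [e e1] := @unit_sphere_nonempty R n n_gt0; exists (haar_moment4 e) => z.
rewrite (@haar_moment4_isotropic z (enorm z *: e)); last first.
  by rewrite dotvZl dotvZr (unit_sphereP e).1// mulr1 -expr2 enorm_sqr.
rewrite /haar_moment4 -enorm_sqr -exprM -RintegralZr//.
by apply: eq_Rintegral => t _; rewrite dotvZl exprMn mulrC.
Qed.

(** Polarization: with [a = <z, U x>] and [b = <w, U x>],
    [12 a^2 b^2 + 2 a^4 + 2 b^4 = (a + b)^4 + (a - b)^4]. *)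
Lemma haar_moment22E : exists c, forall z w,
  (\int[Q]_t (dotv z (U t *m x) ^+ 2 * dotv w (U t *m x) ^+ 2)%:E)%E =
  (c * (dotv z z * dotv w w + 2 * dotv z w ^+ 2))%:E.
Proof.
have [c cE] := haar_moment4E; exists (c / 3) => z w.
have i22 : Q.-integrable setT (EFin \o (fun t => dotv z (y t) ^+ 2 * dotv w (y t) ^+ 2)).
  apply: (@bounded_integrable _ _ _ _ _ (dotv z z * dotv x x * (dotv w w * dotv x x))).
    by apply: measurable_funM; exact: measurable_funX.
  move=> t; rewrite ger0_norm; last by rewrite mulr_ge0 ?sqr_ge0.
  by rewrite ler_pM ?sqr_ge0.
rewrite -[LHS]fineK; last exact: integrable_fin_num.
congr EFin; apply: (@mulfI _ 12); first by rewrite pnatr_eq0.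
have polar : \int[Q]_t (12 * (dotv z (y t) ^+ 2 * dotv w (y t) ^+ 2)) +
    (2 * haar_moment4 z + 2 * haar_moment4 w) =
    haar_moment4 (z + w) + haar_moment4 (z - w).
  have int12 := integrableZl measurableT 12 i22.
  have int2 v := integrableZl measurableT 2 (int4 v).
  rewrite /haar_moment4 -!RintegralZl// -!RintegralD//; last 3 first.
  - exact: (integrableD measurableT (int2 z) (int2 w)).
  - exact: int2.
  - exact: int2.
  by apply: eq_Rintegral => t _; rewrite dotvDl dotvBl /y; ring.
apply: (addIr (2 * haar_moment4 z + 2 * haar_moment4 w)).
rewrite -RintegralZl// polar !cE !(dotvBl, dotvBr) !(dotvDl, dotvDr) (dotvC w z).
by field.
Qed.

(** Expand [|T U x|^2] as the sum of the [<t_i, U x>^2] over the rows [t_i]. *)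
Lemma haar_fourth_moment (T : 'M[R]_n) :
  (\int[Q]_t (dotv (T *m (U t *m x)) (T *m (U t *m x)) ^+ 2)%:E)%E =
  (dotv x x ^+ 2 / (n%:R * (n%:R + 2)) *
    ((hs_norm T ^+ 2) ^+ 2 + 2 * hs_norm (T *m T^T) ^+ 2))%:E.
Proof.
have [c cE] := haar_moment22E.
have momE (S : 'M[R]_n) :
    (\int[Q]_t (dotv (S *m (U t *m x)) (S *m (U t *m x)) ^+ 2)%:E)%E =
    (c * ((hs_norm S ^+ 2) ^+ 2 + 2 * hs_norm (S *m S^T) ^+ 2))%:E.
  transitivity (\int[Q]_t \sum_i \sum_j
      (dotv (rowv S i) (y t) ^+ 2 * dotv (rowv S j) (y t) ^+ 2)%:E)%E.
    apply: eq_integral => t _; rewrite dotv_mulmx_rowv expr2 mulr_suml -sumEFin.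
    by apply: eq_bigr => i _; rewrite mulr_sumr sumEFin.
  have m22 i j : measurable_fun setT (fun t =>
      (dotv (rowv S i) (y t) ^+ 2 * dotv (rowv S j) (y t) ^+ 2)%:E).
    by apply/measurable_EFinP; apply: measurable_funM; exact: measurable_funX.
  have m22_ge0 i j t :
      (0 <= (dotv (rowv S i) (y t) ^+ 2 * dotv (rowv S j) (y t) ^+ 2)%:E)%E.
    by rewrite lee_fin mulr_ge0 ?sqr_ge0.
  rewrite ge0_integral_sum//; last 2 first.
  - by move=> i; exact: emeasurable_sum.
  - by move=> i t _; exact: sume_ge0.
  under eq_bigr do [rewrite ge0_integral_sum//; under eq_bigr do rewrite cE].
  under eq_bigr do rewrite sumEFin.
  rewrite sumEFin; congr EFin.
  under eq_bigr do rewrite -mulr_sumr big_split/= -!mulr_sumr.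
  by rewrite -mulr_sumr big_split/= -mulr_suml -mulr_sumr -hs_norm_gram -hs_norm_sqr -expr2.
rewrite momE; congr (_ * _)%:E.
(* The identity matrix determines c, since |U x| = |x|. *)
have /eqP := momE 1%:M; rewrite trmx1 mulmx1 hs_norm1.
under eq_integral do rewrite mul1mx dotv_y.
have := expectation_cst Q (dotv x x ^+ 2); rewrite unlock => ->.
rewrite eqe => /eqP ->.
have n0 : (0 : R) < n%:R by rewrite ltr0n.
by field; rewrite !gt_eqF// addr_gt0.
Qed.

End haar_moments.

(** * Moments of an isotropic vector *)

Section second_moment.
Context {R : realType} d (Omega : measurableType d) (P : probability Omega R).

(** Integrate [(Y - m)^2 + 2 m Y = Y^2 + m^2]: all terms are nonnegative, so
    the identity holds even when both sides are infinite. *)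
Lemma variance_second_moment (Y : Omega -> R) (m : R) :
  measurable_fun setT Y -> (forall w, 0 <= Y w) -> ('E_P[Y] = m%:E)%E ->
  ('V_P[Y] + (m ^+ 2)%:E = \int[P]_w (Y w ^+ 2)%:E)%E.
Proof.
move=> mY Y0 EY.
have m0 : 0 <= m by rewrite -lee_fin -EY expectation_ge0.
have VE : ('V_P[Y] = \int[P]_w ((Y w - m) ^+ 2)%:E)%E.
  rewrite /variance covariance.unlock EY /= unlock.
  by apply: eq_integral => w _; rewrite expr2.
have Ecst r : (\int[P]_w r%:E = r%:E :> \bar R)%E.
  by have := expectation_cst P r; rewrite unlock.
have mYm : measurable_fun setT (fun w => ((Y w - m) ^+ 2)%:E).
  apply/measurable_EFinP; apply: measurable_funX.
  by apply: measurable_funB => //; exact: measurable_cst.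
have mY2 : measurable_fun setT (fun w => (Y w ^+ 2)%:E).
  by apply/measurable_EFinP; exact: measurable_funX.
have mEY : measurable_fun setT (fun w => (Y w)%:E) by exact/measurable_EFinP.
have : (\int[P]_w (((Y w - m) ^+ 2)%:E + (2 * m)%:E * (Y w)%:E) =
        \int[P]_w ((Y w ^+ 2)%:E + (m ^+ 2)%:E))%E.
  by apply: eq_integral => w _; rewrite -EFinM -!EFinD; congr EFin; ring.
rewrite ge0_integralD//; last 3 first.
- by move=> w _; rewrite lee_fin sqr_ge0.
- by move=> w _; rewrite mule_ge0// lee_fin// mulr_ge0.
- exact: measurable_funeM.
rewrite ge0_integralD//; last 2 first.
- by move=> w _; rewrite lee_fin sqr_ge0.
- by move=> w _; rewrite lee_fin sqr_ge0.
rewrite ge0_integralZl//; last 2 first.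
- by move=> w _; rewrite lee_fin.
- by rewrite lee_fin mulr_ge0.
rewrite -VE Ecst; move: EY; rewrite unlock => ->.
rewrite -EFinM (_ : 2 * m * m = m ^+ 2 + m ^+ 2); last by ring.
by rewrite EFinD addeA => /(congr1 (fun a => a - (m ^+ 2)%:E)%E); rewrite !addeK.
Qed.

End second_moment.

Section isotropic_moments.
Context {R : realType} (n : nat) d (Omega : measurableType d).
Context (P : probability Omega R) (X : {mfun Omega >-> 'cV[R]_n}).
Hypothesis isoX : isotropic P X.

Let mX i : measurable_fun setT (fun w => X w i ord0).
Proof. exact: (measurableT_comp (measurable_entry i ord0)). Qed.

Let covX i j : (\int[P]_w (X w i ord0 * X w j ord0)%:E = (i == j)%:R%:E)%E.
Proof. by have := isoX.2 i j; rewrite unlock. Qed.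

Let intX2 i : P.-integrable setT (EFin \o (fun w => X w i ord0 * X w i ord0)).
Proof.
apply/integrableP; split; first by apply/measurable_EFinP; exact: measurable_funM.
rewrite (eq_integral (fun w => (X w i ord0 * X w i ord0)%:E)) ?covX ?ltry// => w _.
by rewrite /= ger0_norm// -expr2 sqr_ge0.
Qed.

(* |X_i X_j| <= X_i^2 + X_j^2, and the squares are integrable by isotropy. *)
Let intX i j : P.-integrable setT (EFin \o (fun w => X w i ord0 * X w j ord0)).
Proof.
apply: le_integrable (integrableD measurableT (intX2 i) (intX2 j)) => //.
  by apply/measurable_EFinP; exact: measurable_funM.
move=> w _; rewrite /= lee_fin -!expr2.
rewrite [leRHS]ger0_norm ?addr_ge0 ?sqr_ge0// ler_norml.
have := sqr_ge0 (X w i ord0 + X w j ord0).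
have := sqr_ge0 (X w i ord0 - X w j ord0).
have := sqr_ge0 (X w i ord0).
have := sqr_ge0 (X w j ord0).
by move=> *; apply/andP; split; nra.
Qed.

Lemma isotropic_dotv_sqr s :
  (\int[P]_w (dotv s (X w) ^+ 2)%:E = (dotv s s)%:E)%E.
Proof.
transitivity (\int[P]_w \sum_i \sum_j
    (s i ord0 * s j ord0)%:E * (X w i ord0 * X w j ord0)%:E)%E.
  apply: eq_integral => w _; rewrite expr2 mulr_suml -sumEFin.
  apply: eq_bigr => i _; rewrite mulr_sumr -sumEFin.
  by apply: eq_bigr => j _; rewrite -EFinM; congr EFin; ring.
have intZ i j := integrableZl measurableT (s i ord0 * s j ord0) (intX i j).
rewrite integral_sum//; last by move=> i; exact: integrable_sum.
rewrite -sumEFin; apply: eq_bigr => i _.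
rewrite integral_sum//.
rewrite (bigD1 i)//= big1 ?adde0 => [|j ji].
  by rewrite integralZl ?covX ?eqxx ?mule1//; exact: intX.
rewrite integralZl//; last exact: intX.
by rewrite covX eq_sym (negbTE ji) mule0.
Qed.

Lemma isotropic_expectation_sqr (T : 'M[R]_n) :
  ('E_P[fun w => (enorm (T *m X w) ^+ 2)%R] = (hs_norm T ^+ 2)%:E)%E.
Proof.
rewrite unlock hs_norm_sqr -sumEFin.
under eq_integral do rewrite enorm_sqr dotv_mulmx_rowv -sumEFin.
rewrite ge0_integral_sum//; last 2 first.
- move=> i; apply/measurable_EFinP; apply: measurable_funX.
  by apply: measurable_dotv => //; exact: measurable_cst.
- by move=> i w _; rewrite lee_fin sqr_ge0.
by apply: eq_bigr => i _; exact: isotropic_dotv_sqr.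
Qed.

(** [E <T X, xi>^2 = |T^T xi|^2], whose supremum over the sphere is the squared
    operator norm of [T^T]. *)
Lemma isotropic_lambda_sq (T : 'M[R]_n) : (0 < n)%N ->
  lambda_sq P (fun w => T *m X w) = (op_norm T ^+ 2)%:E.
Proof.
move=> n0.
have ET xi : ('E_P[fun w => (dotv (T *m X w) xi ^+ 2)%R] = (enorm (T^T *m xi) ^+ 2)%:E)%E.
  rewrite unlock enorm_sqr -isotropic_dotv_sqr.
  by apply: eq_integral => w _; rewrite dotv_mulmxl dotvC.
rewrite /lambda_sq -op_norm_tr//; apply/eqP; rewrite eq_le; apply/andP; split.
  apply: ge_ereal_sup => _ [xi xi1 <-]; rewrite ET lee_fin lerXn2r//.
  - by rewrite nnegrE enorm_ge0.
  - by rewrite nnegrE op_norm_ge0.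
  - exact: enorm_le_op_norm.
set L := ereal_sup _.
have LT xi : unit_sphere xi -> ((enorm (T^T *m xi) ^+ 2)%:E <= L)%E.
  by move=> xi1; apply: ereal_sup_ubound; exists xi.
have [xi0 xi01] := @unit_sphere_nonempty R n n0.
have L0 : (0 <= L)%E by apply: le_trans (LT _ xi01); rewrite lee_fin sqr_ge0.
case: L L0 LT => [l||]// l0 LT; last by rewrite leey.
rewrite lee_fin in l0; rewrite lee_fin -(sqr_sqrtr l0).
rewrite lerXn2r ?nnegrE ?op_norm_ge0 ?sqrtr_ge0//.
apply: op_norm_le => // xi /LT; rewrite lee_fin => /ler_wsqrtr.
by rewrite sqrtr_sqr ger0_norm// enorm_ge0.
Qed.

End isotropic_moments.

(** * Variance averaged over rotations *)

Section variance_under_rotation.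
Context {R : realType} (n : nat).
Context d (Omega : measurableType d) (P : probability Omega R).
Context (X : {mfun Omega >-> 'cV[R]_n}).
Context d' (Omega' : measurableType d') (Q : probability Omega' R).
Context (U : {mfun Omega' >-> 'M[R]_n}).
Hypothesis n_gt0 : (0 < n)%N.
Hypothesis isoX : isotropic P X.

Lemma isotropic_lambda_sq1 : lambda_sq P X = 1%E.
Proof.
have -> : lambda_sq P X = lambda_sq P (fun w => 1%:M *m X w).
  by congr (lambda_sq P _); apply/funext => w; rewrite mul1mx.
rewrite isotropic_lambda_sq// (_ : op_norm _ = 1) ?expr1n//.
apply/eqP; rewrite eq_le; apply/andP; split.
  by apply: op_norm_le => // xi xi1; rewrite mul1mx xi1.
have [xi xi1] := @unit_sphere_nonempty R n n_gt0.
by have := enorm_le_op_norm 1%:M xi1; rewrite mul1mx xi1.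
Qed.

Let mUX : measurable_fun setT (fun t : Omega' * Omega => U t.1 *m X t.2).
Proof. by apply: measurable_mulmx; exact: measurableT_comp. Qed.

Lemma isotropic_variance (S : 'M[R]_n) :
  ('V_P[fun w => (enorm (S *m X w) ^+ 2)%R] + ((hs_norm S ^+ 2) ^+ 2)%:E =
   \int[P]_w (dotv (S *m X w) (S *m X w) ^+ 2)%:E)%E.
Proof.
rewrite (@variance_second_moment _ _ _ P _ (hs_norm S ^+ 2)).
- by apply: eq_integral => w _; rewrite enorm_sqr.
- under eq_fun do rewrite enorm_sqr.
  by apply: measurable_dotv; apply: measurable_mulmx => //; exact: measurable_cst.
- by move=> w; exact: sqr_ge0.
- exact: isotropic_expectation_sqr.
Qed.

(** [E |X|^4 = Var |X|^2 + n^2], because [E |X|^2 = n]. *)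
Lemma isotropic_fourth_moment_le (C1 : R) : variance_conjecture_with P C1 X ->
  (\int[P]_w (dotv (X w) (X w) ^+ 2)%:E <= (C1 * n%:R + n%:R ^+ 2)%:E)%E.
Proof.
have XE : (fun w => enorm (X w) ^+ 2) = (fun w => enorm (1%:M *m X w) ^+ 2).
  by apply/funext => w; rewrite mul1mx.
rewrite /variance_conjecture_with isotropic_lambda_sq1 mule1 XE.
rewrite isotropic_expectation_sqr// hs_norm1 -EFinM => VX.
have := isotropic_variance 1%:M; rewrite hs_norm1.
under eq_integral do rewrite mul1mx.
by move=> <-; rewrite EFinD leeD2r.
Qed.

Hypothesis haarU : uniform_on_orthogonal_group Q U.

(** Tonelli turns the average over [U] into the fourth moment of [T U x] for
    fixed [x], which is an explicit multiple of [|x|^4]. *)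
Lemma average_variance (T : 'M[R]_n) :
  (\int[Q]_t 'V_P[fun w => (enorm (T *m (U t *m X w)) ^+ 2)%R] +
     ((hs_norm T ^+ 2) ^+ 2)%:E =
   (((hs_norm T ^+ 2) ^+ 2 + 2 * hs_norm (T *m T^T) ^+ 2) /
      (n%:R * (n%:R + 2)))%:E *
   \int[P]_w (dotv (X w) (X w) ^+ 2)%:E)%E.
Proof.
set h := (hs_norm T ^+ 2) ^+ 2; set k := _ / _.
have k0 : 0 <= k.
  apply: divr_ge0; last by rewrite mulr_ge0 ?addr_ge0.
  by rewrite addr_ge0 ?sqr_ge0// pmulr_rge0 ?sqr_ge0.
pose f (p : Omega' * Omega) : \bar R :=
  (dotv (T *m (U p.1 *m X p.2)) (T *m (U p.1 *m X p.2)) ^+ 2)%:E.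
have mf : measurable_fun setT f.
  apply/measurable_EFinP; apply: measurable_funX.
  by apply: measurable_dotv; apply: measurable_mulmx.
have f0 p : (0 <= f p)%E by rewrite lee_fin sqr_ge0.
have VE t : ('V_P[fun w => (enorm (T *m (U t *m X w)) ^+ 2)%R] + h%:E =
    \int[P]_w f (t, w))%E.
  have := isotropic_variance (T *m U t).
  rewrite hs_norm_orthogonal; last exact: haarU.1.
  have -> : (fun w => enorm (T *m U t *m X w) ^+ 2) =
      (fun w => enorm (T *m (U t *m X w)) ^+ 2).
    by apply/funext => w; rewrite mulmxA.
  by move=> ->; apply: eq_integral => w _; rewrite /f /= mulmxA.
transitivity (\int[Q]_t \int[P]_w f (t, w))%E.
  under [RHS]eq_integral do rewrite -VE.
  have := expectation_cst Q h; rewrite unlock => hE.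
  rewrite ge0_integralD//; first by rewrite hE.
  - by move=> t _; exact: variance_ge0.
  - apply: (eq_measurable_fun (fun t => \int[P]_w f (t, w) - h%:E)%E).
      by move=> t _; rewrite -VE addeK.
    apply: emeasurable_funB; last exact: measurable_cst.
    exact: measurable_fun_fubini_tonelli_F.
  - by move=> t _; rewrite lee_fin sqr_ge0.
rewrite (@fubini_tonelli _ _ _ _ _ Q P f)//.
rewrite -ge0_integralZl//; last 2 first.
- by apply/measurable_EFinP; apply: measurable_funX; exact: measurable_dotv.
- by move=> w _; rewrite lee_fin sqr_ge0.
apply: eq_integral => w _; rewrite /f /= (haar_fourth_moment n_gt0 haarU) -EFinM.
by congr EFin; rewrite /k /h; ring.
Qed.

End variance_under_rotation.

Theorem proposition2p1 (R : realType) :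
  exists C : R, 0 < C /\
  forall (n : nat) (d : measure_display) (Omega : measurableType d)
    (P : probability Omega R) (X : {mfun Omega >-> 'cV[R]_n})
    (d' : measure_display) (Omega' : measurableType d')
    (Q : probability Omega' R) (U : {mfun Omega' >-> 'M[R]_n})
    (C1 : R) (T : 'M[R]_n),
  (0 < n)%N ->
  log_concave P X -> isotropic P X ->
  (* with C1 allowed to tend to 0 the inequality is false *)
  1 <= C1 -> variance_conjecture_with P C1 X ->
  T \in unitmx ->
  uniform_on_orthogonal_group Q U ->
  (\int[Q]_w' 'V_P[fun w => (enorm (T *m (U w' *m X w)) ^+ 2)%R]
     <= (C * C1 * op_norm T ^+ 2 * hs_norm T ^+ 2)%R%:E)%E /\
  forall u, orthogonal_group u ->
    (C * C1 * op_norm T ^+ 2 * hs_norm T ^+ 2)%:E =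
    ((C * C1)%:E * lambda_sq P (fun w => (T *m (u *m X w))%R)
       * 'E_P[fun w => (enorm (T *m (u *m X w)) ^+ 2)%R])%E.
Proof.
exists 3; split=> // n d Omega P X d' Omega' Q U C1 T n_gt0 _ isoX C1_ge1 varX _ haarU.
split=> [|u ou]; last first.
  have TuE : (fun w => T *m (u *m X w)) = (fun w => T *m u *m X w).
    by apply/funext => w; rewrite mulmxA.
  have -> : (fun w => enorm (T *m (u *m X w)) ^+ 2) =
      (fun w => enorm (T *m u *m X w) ^+ 2).
    by apply/funext => w; rewrite mulmxA.
  rewrite TuE isotropic_lambda_sq// isotropic_expectation_sqr//.
  by rewrite op_norm_orthogonal// hs_norm_orthogonal// -!EFinM.
rewrite -(@leeD2rE _ ((hs_norm T ^+ 2) ^+ 2)%:E)// average_variance//.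
set h := hs_norm T ^+ 2; set g := hs_norm (T *m T^T) ^+ 2.
set a := op_norm T ^+ 2; set N : R := n%:R.
have h0 : 0 <= h by exact: sqr_ge0.
have g0 : 0 <= g by exact: sqr_ge0.
have a0 : 0 <= a by exact: sqr_ge0.
have N1 : 1 <= N by rewrite /N ler1n.
have gah : g <= a * h := hs_norm_gram_le T.
have hNa : h <= N * a := hs_norm_le_op T n_gt0.
have N0 : 0 < N * (N + 2) by rewrite mulr_gt0//; lra.
apply: le_trans (lee_wpmul2l _ (isotropic_fourth_moment_le n_gt0 isoX varX)) _.
  by rewrite lee_fin divr_ge0 ?(ltW N0)// addr_ge0 ?sqr_ge0// pmulr_rge0.
rewrite -EFinM -EFinD lee_fin.
rewrite (_ : _ * (C1 * _ + _) = (h ^+ 2 + 2 * g) * (C1 + N) / (N + 2)); last first.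
  by rewrite -/N; field; apply/andP; split; rewrite gt_eqF//; lra.
rewrite ler_pdivrMr; last by lra.
have C1_ge0 : 0 <= C1 by lra.
have ah0 : 0 <= a * h by exact: mulr_ge0.
have Cah0 : 0 <= C1 * (a * h) by exact: mulr_ge0.
have trace_sq : h ^+ 2 * C1 <= N * (C1 * (a * h)).
  have : C1 * h * h <= C1 * h * (N * a) by apply: ler_wpM2l => //; exact: mulr_ge0.
  by lra.
have gram : g * (C1 + N) <= C1 * (a * h) * (N + 2).
  apply: (@le_trans _ _ (a * h * (C1 * (N + 2)))); last by lra.
  by apply: ler_pM => //; nra.
have := sqr_ge0 h.
by lra.
Qed.
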